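(* Let $U=(u_{kj})$ be a complex $r\times m$ matrix and $V=(v_{ik})$ an integer $s\times r$ matrix, and let $f:\mathbb C^m\dashrightarrow\mathbb C^s$ be the rational map with coordinates $f_i(x)=\prod_{k=1}^r(u_{k1}x_1+\dots+u_{km}x_m)^{v_{ik}}$, $i=1,\dots,s$. Let $Y_{UV}\subseteq\mathbb C^s$ be the Zariski closure of the image of $f$, and let $\mathrm{im}(U)\subseteq\mathbb C^r$ be the image of $U$. Then $\tau(Y_{UV})=V\cdot\tau(\mathrm{im}(U))$, i.e. the tropicalization of $Y_{UV}$ is the image of $\tau(\mathrm{im}(U))\subseteq\mathbb R^r$ under the linear map $\mathbb R^r\to\mathbb R^s$ given by $V$.
   Context: Let $K=\mathbb C\{\!\{\epsilon^{\mathbb R}\}\!\}$ be the field of (transfinite) Puiseux series with complex coefficients, real exponents and well-ordered support; the order of $z\in K^*$ is the smallest exponent appearing in $z$, and for $z\in(K^* )^s$, $\mathrm{order}(z)\in\mathbb R^s$ is taken coordinatewise. For an algebraic variety $Y\subseteq\mathbb C^s$ (or $\mathbb C^r$) defined over $\mathbb C$, its tropicalization $\tau(Y)$ is the closure of the set $\{\mathrm{order}(z): z\in Y(K)\cap(K^* )^s\}$; equivalently $\tau(Y)=\{w:\mathrm{in}_w(I_Y)\text{ contains no monomial}\}$, where $\mathrm{in}_w$ takes lowest $w$-weight terms. $\tau(\mathrm{im}(U))$ is the Bergman fan of $U$: the set of $w\in\mathbb R^r$ such that every element of $[r]$ lies in some basis of the row matroid of $U$ of maximal $w$-weight.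
   Formalization: The image of f is taken over points x where all r linear forms are nonzero, so if a row of U is zero, Y_UV is empty; otherwise Y_UV is unchanged. With a zero row of U and a zero matching column of V (and 0^0=1) the claim as written fails. τ is defined by initial ideals. *)

(* Defs.v *)
From HB Require Import structures.
From mathcomp Require Import all_boot all_order all_algebra.
From mathcomp Require Import Rstruct.
From mathcomp Require Import complex.
From mathcomp Require Import mpoly.
Set Implicit Arguments. Unset Strict Implicit. Unset Printing Implicit Defensive.
Import Order.TTheory GRing.Theory Num.Theory.
Local Open Scope ring_scope.

Definition RR : realFieldType := Rdefinitions.R.
Definition CC := (Rdefinitions.R)[i].

Definition mweight (n : nat) (w : 'I_n -> RR) (a : 'X_{1..n}) : RR :=
  \sum_(i < n) w i * (a i)%:R.

Definition initial_form (n : nat) (w : 'I_n -> RR) (g : {mpoly CC[n]})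
  : {mpoly CC[n]} :=
  \sum_(a <- msupp g | all (fun b => mweight w a <= mweight w b) (msupp g))
     g@_a *: 'X_[a].

Definition initial_ideal (n : nat) (w : 'I_n -> RR)
  (I : {mpoly CC[n]} -> Prop) (p : {mpoly CC[n]}) : Prop :=
  exists (k : nat) (h g : 'I_k -> {mpoly CC[n]}),
    (forall j, I (g j)) /\ p = \sum_(j < k) h j * initial_form w (g j).

(* the vanishing ideal of a subset S of C^n (= ideal of its Zariski closure) *)
Definition vanishing_ideal (n : nat) (S : ('I_n -> CC) -> Prop)
  (g : {mpoly CC[n]}) : Prop :=
  forall y, S y -> g.@[y] = 0.

(* tropicalization of the Zariski closure Y of S:
   tau(Y) = { w in R^n : in_w(I_Y) contains no monomial } *)
Definition trop_closure (n : nat) (S : ('I_n -> CC) -> Prop)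
  (w : 'I_n -> RR) : Prop :=
  ~ (exists a : 'X_{1..n}, initial_ideal w (vanishing_ideal S) 'X_[a]).

Definition linforms (r m : nat) (U : 'M[CC]_(r, m)) (x : 'I_m -> CC)
  : 'I_r -> CC :=
  fun k => \sum_(j < m) U k j * x j.

Definition imU (r m : nat) (U : 'M[CC]_(r, m)) : ('I_r -> CC) -> Prop :=
  fun z => exists x : 'I_m -> CC, z = linforms U x.

Definition fUV (r m s : nat) (U : 'M[CC]_(r, m)) (V : 'M[int]_(s, r))
  (x : 'I_m -> CC) : 'I_s -> CC :=
  fun i => \prod_(k < r) (linforms U x k) ^ (V i k).

Definition image_fUV (r m s : nat) (U : 'M[CC]_(r, m)) (V : 'M[int]_(s, r))
  : ('I_s -> CC) -> Prop :=
  fun y => exists x : 'I_m -> CC,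
    (forall k, linforms U x k != 0) /\ y = fUV U V x.

Definition Vmap (r s : nat) (V : 'M[int]_(s, r)) (w : 'I_r -> RR)
  : 'I_s -> RR :=
  fun i => \sum_(k < r) (V i k)%:~R * w k.

(* Main.v *)
Require Import Defs.
From HB Require Import structures.
From mathcomp Require Import all_boot all_order all_algebra.
From mathcomp Require Import Rstruct complex mpoly.
From mathcomp Require Import ring lra boolp functions.
From mathcomp Require classical_sets.
Import Order.TTheory GRing.Theory Num.Theory.
Set Implicit Arguments. Unset Strict Implicit. Unset Printing Implicit Defensive.
Local Open Scope ring_scope.

(** Call [w] Bergman when no row of [U] lies in the span of the rows of strictly
    larger [w]-weight. A linear relation with a unique term of lowest weight shows
    that every [w] in [tau (im U)] is Bergman. Conversely, a Bergman [w] is realised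
    by a curve [x(t) = sum_k s^k t^(w_k) xi_k], [t -> 0+], on which the [k]-th form
    is asymptotic to [c_k t^(w_k)] with [c_k <> 0]; then [c] is a torus zero of all
    initial forms of the ideal of [im U], and likewise [prod_k c_k^(v_ik)] is one
    for the ideal of [Y_UV] and the weight [V w].

    For the remaining inclusion let [z] be in [tau (Y_UV)]. In the ring of functions
    on the set where no linear form vanishes, the Laurent polynomials in [f] with
    exponents of positive [z]-weight form a nonunital subring without [1]. Enlarge
    it to a maximal one [P]; by Chevalley's argument its multipliers behave like a
    valuation ring with maximal ideal [P], and this preorders the linear forms.
    Fourier-Motzkin elimination gives a real [w] with [V w = z] compatible with this
    preorder: a certificate of infeasibility is an integral [lam] with
    [lam . z > 0], hence [f^lam] in [P], for which [f^(-lam)] is a multiplier of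
    [P], which would put [1] in [P]. Compatibility with the preorder makes [w]
    Bergman. *)

(** * Maximal nonunital subrings and Chevalley's extension argument *)

Section MaximalNonunitalSubring.
Variables (R : comPzRingType) (D : R -> Prop).

Definition nonunital_subring (P : R -> Prop) :=
  [/\ P 0, forall x y, P x -> P y -> P (x - y),
      forall x y, P x -> P y -> P (x * y) &
      forall d x, D d -> P x -> P (d * x)].

(* For a maximal [P] not containing [1], the multipliers of [P] play the role of
   a valuation ring with maximal ideal [P]. *)
Definition multiplier (P : R -> Prop) (x : R) := forall p, P p -> P (x * p).

Section Adjoin.
Variable P : R -> Prop.
Hypothesis subP : nonunital_subring P.

Let P0 : P 0. Proof. by case: subP. Qed.
Let PB x y : P x -> P y -> P (x - y). Proof. by case: subP => _ + _ _; apply. Qed.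
Let PM x y : P x -> P y -> P (x * y). Proof. by case: subP => _ _ + _; apply. Qed.
Let PZ d x : D d -> P x -> P (d * x). Proof. by case: subP => _ _ _; apply. Qed.

Lemma nonunital_subringN x : P x -> P (- x).
Proof. by move=> Px; rewrite -sub0r; apply: PB. Qed.

Lemma nonunital_subringD x y : P x -> P y -> P (x + y).
Proof. by move=> Px Py; rewrite -[y]opprK; apply/PB/nonunital_subringN. Qed.

Lemma nonunital_subring_sum (I : Type) (s : seq I) (Q : pred I) (F : I -> R) :
  (forall i, Q i -> P (F i)) -> P (\sum_(i <- s | Q i) F i).
Proof. by move=> PF; apply: (big_ind P) => //; apply: nonunital_subringD. Qed.

Lemma multiplierM x y : multiplier P x -> multiplier P y -> multiplier P (x * y).
Proof. by move=> Ox Oy p Pp; rewrite -mulrA; apply/Ox/Oy. Qed.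

Lemma multiplier1 : multiplier P 1.
Proof. by move=> p; rewrite mul1r. Qed.

Lemma multiplierB x y : multiplier P x -> multiplier P y -> multiplier P (x - y).
Proof. by move=> Ox Oy p Pp; rewrite mulrBl; apply: PB; [apply: Ox|apply: Oy]. Qed.

Lemma multiplier_sub x : P x -> multiplier P x.
Proof. by move=> Px p; apply: PM. Qed.

(* Values at [x] of the polynomials of degree at most [n] with coefficients in
   [P], in Horner form. *)
Fixpoint horner_span (x : R) (n : nat) (y : R) : Prop :=
  if n is n'.+1 then exists p y', [/\ P p, horner_span x n' y' & y = p + x * y']
  else P y.

Lemma horner_spanS x n y : horner_span x n y -> horner_span x n.+1 y.
Proof.
elim: n y => [|n IHn] y; first by exists y, 0; rewrite mulr0 addr0.
by move=> [p [y' [Pp /IHn Sy' ->]]]; exists p, y'.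
Qed.

Lemma horner_span_leq x n m y : (n <= m)%N -> horner_span x n y -> horner_span x m y.
Proof.
move=> /subnK <-; elim: (m - n)%N => // k IHk /IHk.
by rewrite addSn; apply: horner_spanS.
Qed.

Lemma horner_spanP x n p : P p -> horner_span x n p.
Proof. exact: (@horner_span_leq x 0). Qed.

Lemma horner_spanB x n y1 y2 :
  horner_span x n y1 -> horner_span x n y2 -> horner_span x n (y1 - y2).
Proof.
elim: n y1 y2 => [|n IHn] y1 y2 /=; first exact: PB.
move=> [p1 [z1 [Pp1 S1 ->]]] [p2 [z2 [Pp2 S2 ->]]].
exists (p1 - p2), (z1 - z2); split; [exact: PB|exact: IHn|ring].
Qed.

Lemma horner_spanD x n y1 y2 :
  horner_span x n y1 -> horner_span x n y2 -> horner_span x n (y1 + y2).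
Proof.
move=> S1 S2; rewrite -[y2]opprK; apply: horner_spanB => //.
by rewrite -sub0r; apply: horner_spanB => //; apply: horner_spanP.
Qed.

Lemma horner_spanZ x n o y :
  multiplier P o -> horner_span x n y -> horner_span x n (o * y).
Proof.
move=> Oo; elim: n y => [|n IHn] y /=; first exact: Oo.
move=> [p [z [Pp S ->]]]; exists (o * p), (o * z).
split; [exact: Oo|exact: IHn|ring].
Qed.

Lemma horner_spanX x n y : horner_span x n y -> horner_span x n.+1 (x * y).
Proof. by move=> S; exists 0, y; rewrite add0r. Qed.

Lemma horner_spanM x n m y z :
  horner_span x n y -> horner_span x m z -> horner_span x (n + m) (y * z).
Proof.
move=> + Sz; elim: n y => [|n IHn] y /=.
  by move=> Py; apply: horner_spanZ => //; apply: multiplier_sub.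
move=> [p [y' [Pp /IHn S ->]]].
rewrite mulrDl -mulrA; apply: (@horner_spanD x (n + m).+1).
  apply: (@horner_span_leq x m); first by rewrite leqW ?leq_addl.
  by apply: horner_spanZ => //; apply: multiplier_sub.
exact: horner_spanX.
Qed.

Lemma horner_span_Xn x n p : P p -> horner_span x n (p * x ^+ n).
Proof.
move=> Pp; elim: n => [|n IHn]; first by rewrite /= mulr1.
by rewrite exprS mulrCA; apply: horner_spanX.
Qed.

Lemma horner_span_lead x n y : horner_span x n.+1 y ->
  exists y' p, [/\ horner_span x n y', P p & y = y' + p * x ^+ n.+1].
Proof.
elim: n y => [|n IHn] y.
  by move=> [p [y' [Pp /= Py' ->]]]; exists p, y'; rewrite mulrC.
move=> [p [y' [Pp /IHn[z [q [Sz Pq ->]]] ->]]].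
exists (p + x * z), q; split=> //; last by rewrite !exprS; ring.
by exists p, z.
Qed.

(** Multiplying by [x ^+ n] turns each power [x' ^+ i], [i <= m], into [x ^+ (n - i)]. *)
Lemma horner_span_flip x x' n m y : x * x' = 1 -> (m <= n)%N ->
  horner_span x' m y -> horner_span x n (x ^+ n * y).
Proof.
move=> xx'; elim: m n y => [|m IHm] [|n] y //.
- by move=> _; rewrite mul1r.
- by move=> _ Py; rewrite mulrC; apply: horner_span_Xn.
rewrite ltnS => /IHm{}IHm [p [y' [Pp /IHm S ->]]].
rewrite mulrDr; apply: horner_spanD; first by rewrite mulrC; apply: horner_span_Xn.
by rewrite exprSr mulrA -(mulrA (x ^+ n)) xx' mulr1; apply: horner_spanS.
Qed.

Lemma horner_span1_reduce x x' n m : x * x' = 1 -> (m <= n)%N ->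
  horner_span x n.+1 1 -> horner_span x' m.+1 1 -> horner_span x n 1.
Proof.
move=> xx' le_mn /horner_span_lead[y [a [Sy Pa e1]]] [b [y' [Pb Sy' e2]]].
(* Multiplying [1 - y = a * x ^+ n.+1] by [1 - b] replaces a factor [x * (1 - b)] by [y'], and
   [x ^+ n * y'] has degree at most [n] in [x]. *)
have -> : 1 = b + (y - b * y) + a * (x ^+ n * y').
  have e3 : x * (1 - b) = y' by rewrite {1}e2 addrC addKr mulrA xx' mul1r.
  have e4 : a * (x ^+ n * y') = (1 - b) * (1 - y).
    have -> : 1 - y = a * x ^+ n.+1 by rewrite {1}e1 addrC addKr.
    by rewrite -e3 exprSr; ring.
  by rewrite e4; ring.
apply: horner_spanD; first apply: horner_spanD.
- exact: horner_spanP.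
- by apply: horner_spanB => //; apply: horner_spanZ => //; apply: multiplier_sub.
- by apply: horner_spanZ; [apply: multiplier_sub|apply: horner_span_flip Sy'].
Qed.

(* Chevalley's argument: eliminating the top coefficient of one relation by the
   other lowers the degrees until one of them is zero. *)
Lemma horner_span1_inv x x' n m : x * x' = 1 ->
  horner_span x n 1 -> horner_span x' m 1 -> P 1.
Proof.
move=> xx'; have [k] := ubnP (n + m); elim: k n m => // k IHk [//|n] [//|m].
rewrite ltnS => le_nm Sn Sm; have [le_mn|/ltnW le_nm'] := leqP m n.
  by apply: (IHk n m.+1) => //; apply: horner_span1_reduce Sn Sm.
apply: (IHk n.+1 m) => //; first by move: le_nm; rewrite addnS.
by apply: horner_span1_reduce Sm Sn => //; rewrite mulrC.
Qed.

Lemma nonunital_subring_horner_span x :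
  nonunital_subring (fun y => exists n, horner_span x n y).
Proof.
split.
- by exists 0%N.
- move=> y z [n Sy] [m Sz]; exists (maxn n m).
  by apply: horner_spanB; [move: Sy|move: Sz];
    apply: horner_span_leq; rewrite ?leq_maxl ?leq_maxr.
- by move=> y z [n Sy] [m Sz]; exists (n + m)%N; apply: horner_spanM.
- by move=> d y Dd [n Sy]; exists n; apply: horner_spanZ => // p; apply: PZ.
Qed.

Lemma horner_span_exp x x' n y : x * x' = 1 -> multiplier P x ->
  horner_span x' n y -> P (x ^+ n * y).
Proof.
move=> xx' Ox; elim: n y => [|n IHn] y /=; first by rewrite mul1r.
move=> [p [y' [Pp /IHn S ->]]].
rewrite mulrDr; apply: nonunital_subringD.
  by elim: n.+1 => [|k IHk]; rewrite ?mul1r // exprS -mulrA; apply: Ox.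
by rewrite exprSr mulrA -(mulrA (x ^+ n)) xx' mulr1.
Qed.

Hypothesis P1 : ~ P 1.
Hypothesis maxP : forall Q : R -> Prop, nonunital_subring Q ->
  (forall x, P x -> Q x) -> ~ Q 1 -> forall x, Q x -> P x.

(** If [1] were not such a value, the values would form a nonunital subring containing [P], hence
    equal to [P] by maximality; they contain [x * p] for every [p] in [P]. *)
Lemma maximal_not_multiplier x :
  ~ multiplier P x -> exists n, horner_span x n 1.
Proof.
move=> nOx; have [//|nS] := pselect (exists n, horner_span x n 1).
case: nOx => p Pp; apply: maxP (nonunital_subring_horner_span x) _ nS _ _.
  by move=> y Py; exists 0%N.
by exists 1%N; apply: horner_spanX.
Qed.

Lemma maximal_inv x x' : x * x' = 1 -> ~ multiplier P x' -> P x.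
Proof.
move=> xx' nOx'; have [n Sn] := maximal_not_multiplier nOx'.
have Ox : multiplier P x.
  have [//|/maximal_not_multiplier[m Sm]] := pselect (multiplier P x).
  by case: P1; apply: horner_span1_inv xx' Sm Sn.
have Pxn : P (x ^+ n) by rewrite -[x ^+ n]mulr1; apply: horner_span_exp xx' Ox Sn.
(* With [O] the set of multipliers, [P + x O] is a nonunital subring containing [P] and [x].
   Maximality gives [P x] unless it contains [1]. *)
pose Q y := exists p o, [/\ P p, multiplier P o & y = p + x * o].
have subQ : nonunital_subring Q.
  split.
  - by exists 0, 0; rewrite mulr0 addr0; split=> // p; rewrite mul0r.
  - move=> _ _ [p1 [o1 [Pp1 Oo1 ->]]] [p2 [o2 [Pp2 Oo2 ->]]].
    exists (p1 - p2), (o1 - o2); split; [exact: PB|exact: multiplierB|ring].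
  - move=> _ _ [p1 [o1 [Pp1 Oo1 ->]]] [p2 [o2 [Pp2 Oo2 ->]]].
    exists (p1 * p2 + o2 * (x * p1) + o1 * (x * p2)), (x * (o1 * o2)); split.
    + apply: nonunital_subringD; last by apply/Oo1/Ox.
      by apply: nonunital_subringD; [exact: PM|apply/Oo2/Ox].
    + by do 2?[apply: multiplierM => //].
    + by ring.
  - move=> d _ Dd [p [o [Pp Oo ->]]]; exists (d * p), (d * o).
    split; [exact: PZ| by apply: multiplierM => // q; apply: PZ|ring].
have [[p [o [Pp Oo e1]]]|nQ1] := pselect (Q 1); last first.
  apply: maxP subQ _ nQ1 _ _.
    by move=> y Py; exists y, 0; rewrite mulr0 addr0; split=> // p; rewrite mul0r.
  by exists 0, 1; rewrite add0r mulr1; split=> //; apply: multiplier1.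
(* Here [1 - p = x * o], so [(1 - p) ^+ n] equals [o ^+ n * x ^+ n], which is in [P]; it is also [1]
   modulo [P]. *)
case: P1; have [q Pq eq1] : exists2 q, P q & (1 - p) ^+ n = 1 - q.
  elim: {Sn Pxn} n => [|n [q Pq IHn]]; first by exists 0; rewrite ?subr0.
  exists (q + p - p * q); last by rewrite exprS IHn; ring.
  by apply: PB; [exact: nonunital_subringD|exact: PM].
have -> : 1 = q + o ^+ n * x ^+ n.
  have xo : x * o = 1 - p by rewrite [in RHS]e1 addrAC subrr add0r.
  by rewrite -exprMn (mulrC o) xo eq1 addrC subrK.
apply: nonunital_subringD => //.
suff Oon k : multiplier P (o ^+ k) by apply: Oon.
by elim: k => [|k IHk]; [apply: multiplier1|rewrite exprS; apply: multiplierM].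
Qed.

End Adjoin.

Lemma maximal_nonunital_subring (P0 : R -> Prop) :
  nonunital_subring P0 -> ~ P0 1 ->
  exists P : R -> Prop, [/\ nonunital_subring P, ~ P 1, forall x, P0 x -> P x &
    forall x x', x * x' = 1 -> ~ multiplier P x' -> P x].
Proof.
move=> sub0 n01.
pose G (A : classical_sets.set R) := (forall x, ~ A x) \/
  [/\ nonunital_subring A, ~ A 1 & forall x, P0 x -> A x].
have [F FG tot|A [GA maxA]] := @classical_sets.Zorn_bigcup R G.
  have [[A [FA [a Aa]]]|nF] := pselect (exists A, F A /\ exists a, A a); last first.
    by left=> x [A FA Ax]; apply: nF; exists A; split=> //; exists x.
  have FP B x : F B -> B x ->
      [/\ nonunital_subring B, ~ B 1 & forall x, P0 x -> B x].
    by move=> /FG[nB /nB|].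
  have join x y B C : F B -> F C -> B x -> C y -> exists2 E, F E & E x /\ E y.
    move=> FB FC Bx Cy; have [BC|CB] := tot B C FB FC.
      by exists C => //; split=> //; apply: BC.
    by exists B => //; split=> //; apply: CB.
  right; split.
  - split.
    + by exists A => //; have [[]] := FP _ _ FA Aa.
    + move=> x y [B FB Bx] [C FC Cy].
      have [E FE [Ex Ey]] := join _ _ _ _ FB FC Bx Cy.
      by exists E => //; have [[_ EB _ _]] := FP _ _ FE Ex; rewrite /=; auto.
    + move=> x y [B FB Bx] [C FC Cy].
      have [E FE [Ex Ey]] := join _ _ _ _ FB FC Bx Cy.
      by exists E => //; have [[_ _ EM _]] := FP _ _ FE Ex; rewrite /=; auto.
    + move=> d x Dd [B FB Bx]; exists B => //.
      by have [[_ _ _ BZ]] := FP _ _ FB Bx; rewrite /=; auto.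
  - by move=> [B FB B1]; have [_ /(_ B1)] := FP _ _ FB B1.
  - by move=> x P0x; exists A => //; have [_ _] := FP _ _ FA Aa; apply.
have [nA|[subA nA1 P0A]] := GA.
  case: (maxA P0); last by right.
  by split=> [x /nA//|/(_ 0)]; case: sub0 => P00 _ _ _ /(_ P00) /nA.
exists A; split=> // x x'; apply: maximal_inv => // Q subQ AQ nQ1 y Qy.
apply: contrapT => nAy; apply: (maxA Q).
  by split=> [z /AQ//|/(_ y Qy)].
by right; split=> // z /P0A/AQ.
Qed.

End MaximalNonunitalSubring.

(** * Fourier-Motzkin elimination over an ordered field, with integral certificates *)

Section FourierMotzkin.
Variables (I : finType) (F : realFieldType).

Definition int_dot (vs : seq I) (a : {ffun I -> int}) (w : I -> F) : F :=
  \sum_(j <- vs) (a j)%:~R * w j.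

Lemma seq_separation (L U : seq F) :
  (forall l u, l \in L -> u \in U -> l <= u) ->
  exists x, (forall l, l \in L -> l <= x) /\ (forall u, u \in U -> x <= u).
Proof.
elim: L => [|l L IHL] LU.
  elim: U {LU} => [|u U [x [_ xU]]]; first by exists 0.
  exists (Num.min u x); split=> // v; rewrite inE ge_min => /predU1P[->|/xU ->].
    by rewrite lexx.
  by rewrite orbT.
have [|x [Lx xU]] := IHL; first by move=> m u mL; apply: LU; rewrite inE mL orbT.
exists (Num.max l x); split=> [m|u uU].
  by rewrite inE le_max => /predU1P[->|/Lx ->]; rewrite ?lexx ?orbT.
by rewrite ge_max xU // LU // inE eqxx.
Qed.

(* The certificate of infeasibility is an element of any given additively closed
   family [K] of inequalities [b <= a . w] that contains the system [cs]. *)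
Lemma fourier_motzkin (vs : seq I) (cs : seq ({ffun I -> int} * F))
    (K : {ffun I -> int} -> F -> Prop) :
  uniq vs ->
  (forall a b a' b', K a b -> K a' b' -> K (a + a') (b + b')) ->
  (forall c, c \in cs -> K c.1 c.2) ->
  (exists w, forall c, c \in cs -> c.2 <= int_dot vs c.1 w) \/
  (exists a b, [/\ K a b, forall j, j \in vs -> a j = 0 & 0 < b]).
Proof.
elim: vs cs K => [|v vs IHvs] cs K.
  move=> _ _ csK.
  have [/allP le0|/allPn[c cs_c]] := boolP (all (fun c => c.2 <= 0) cs).
    by left; exists (fun=> 0) => c /le0; rewrite /int_dot big_nil.
  by rewrite -ltNge => c2; right; exists c.1, c.2; split=> //; apply: csK.
move=> /= /andP[v_vs uvs] KD csK.
have KZ n a b : K a b -> K (a *+ n.+1) (b *+ n.+1).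
  by move=> Kab; elim: n => // n IHn; rewrite !(mulrS _ n.+1); apply: KD.
pose neg := [seq c : {ffun I -> int} * F <- cs | c.1 v < 0].
pose pos := [seq c : {ffun I -> int} * F <- cs | 0 < c.1 v].
(* The factors cancel the coefficient of [v], as [p.1 v > 0 > q.1 v]. They are positive natural
   numbers, so [comb p q] is a sum of members of [K]. *)
pose comb (p q : {ffun I -> int} * F) : {ffun I -> int} * F :=
  (p.1 *+ `|q.1 v|%N + q.1 *+ `|p.1 v|%N, p.2 *+ `|q.1 v|%N + q.2 *+ `|p.1 v|%N).
pose cs' := [seq c : {ffun I -> int} * F <- cs | c.1 v == 0] ++
  [seq comb p q | p <- pos, q <- neg].
have cs'K c : c \in cs' -> K c.1 c.2 /\ c.1 v = 0.
  rewrite mem_cat mem_filter => /orP[/andP[/eqP cv /csK]//|].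
  move=> /allpairsP[[p q] /= [+ + ->]]; rewrite !mem_filter.
  move=> /andP[pv /csK Kp] /andP[qv /csK Kq].
  have [n en] : exists n, p.1 v = n.+1%:Z
    by case: (p.1 v) pv => [[|n]|n] // _; exists n.
  have [m em] : exists m, q.1 v = - m.+1%:Z
    by case: (q.1 v) qv => [m|m] // _; exists m; rewrite NegzE.
  rewrite /comb /= en em abszN !absz_nat; split; first by apply: KD; apply: KZ.
  rewrite ffunE 2!ffunMnE en em mulNrn -[n.+1%:Z]natz -[m.+1%:Z]natz -!mulrnA.
  by rewrite mulnC subrr.
(* Strengthening [K] by [a v = 0] makes a certificate for the reduced system one for the full
   system. *)
have [||[w sol]|[a [b [[Kab av0] a0 b0]]]] :=
    IHvs cs' (fun a b => K a b /\ a v = 0) uvs.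
- move=> a b a' b' [Kab av] [Kab' av']; rewrite ffunE av av'; split=> //; exact: KD.
- exact: cs'K.
(* Solved for the variable [v], an inequality of [pos] is a lower bound and one of [neg] an upper
   bound; the combinations in [cs'] say that each lower bound is at most each upper bound. *)
- left; pose bound (c : {ffun I -> int} * F) :=
    (c.2 - int_dot vs c.1 w) / (c.1 v)%:~R.
  have [l u /mapP[p pP ->] /mapP[q qN ->]|x [Lx xU]] :=
      @seq_separation (map bound pos) (map bound neg).
    have /sol : comb p q \in cs'.
      by rewrite mem_cat; apply/orP; right; apply/allpairsP; exists (p, q).
    move: pP qN; rewrite !mem_filter => /andP[pv _] /andP[qv _].
    have pv' : 0 < (p.1 v)%:~R :> F by rewrite ltr0z.
    have qv' : (q.1 v)%:~R < 0 :> F by rewrite ltrz0.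
    rewrite /bound ler_pdivrMr // mulrAC ler_ndivlMr //=.
    have -> : int_dot vs (p.1 *+ `|q.1 v|%N + q.1 *+ `|p.1 v|%N) w =
        - (q.1 v)%:~R * int_dot vs p.1 w + (p.1 v)%:~R * int_dot vs q.1 w.
      rewrite /int_dot !mulr_sumr -big_split /=; apply: eq_bigr => j _.
      rewrite ffunE 2!ffunMnE intrD !rmorphMn /=.
      rewrite -(mulr_natr (p.1 j)%:~R) -(mulr_natr (q.1 j)%:~R) !natr_absz.
      by rewrite ltr0_norm // gtr0_norm // rmorphN /=; ring.
    rewrite -!(mulr_natr p.2) -!(mulr_natr q.2) !natr_absz.
    by rewrite ltr0_norm // gtr0_norm // rmorphN /=; lra.
  exists (fun j => if j == v then x else w j) => c cs_c.
  have -> : int_dot (v :: vs) c.1 (fun j => if j == v then x else w j) =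
      (c.1 v)%:~R * x + int_dot vs c.1 w.
    rewrite /int_dot big_cons eqxx; congr (_ + _); apply: eq_big_seq => j jvs.
    by case: eqP jvs v_vs => // -> ->.
  have [cv|cv|cv] := ltgtP (c.1 v) 0.
  - have := xU (bound c); rewrite map_f ?mem_filter ?cv // => /(_ isT).
    by rewrite /bound ler_ndivlMr ?ltrz0 // lerBlDr mulrC.
  - have := Lx (bound c); rewrite map_f ?mem_filter ?cv // => /(_ isT).
    by rewrite /bound ler_pdivrMr ?ltr0z // lerBlDr mulrC.
  - rewrite cv mul0r add0r; apply: sol.
    by rewrite mem_cat mem_filter cv eqxx cs_c.
- right; exists a, b; split=> // j; rewrite inE => /predU1P[->//|]; exact: a0.
Qed.

End FourierMotzkin.

(** * Limits of sequences in a normed field *)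

Section Limits.
Variable K : numFieldType.
Implicit Types (h : nat -> K) (c : K).

(** Over [CC] the order is partial, and [0 < e] says that [e] is real and positive. *)
Definition tends_to h c :=
  forall e : K, 0 < e -> exists N, forall n, (N <= n)%N -> `|h n - c| < e.

Lemma tends_to_ext h h' c : h =1 h' -> tends_to h c -> tends_to h' c.
Proof. by move=> e hc e0 /hc[N HN]; exists N => n /HN; rewrite e. Qed.

Lemma tends_to_cst c : tends_to (fun=> c) c.
Proof. by move=> e e0; exists 0%N => n _; rewrite subrr normr0. Qed.

Lemma tends_to2 h h' c c' e : tends_to h c -> tends_to h' c' -> 0 < e ->
  exists N, forall n, (N <= n)%N -> `|h n - c| < e /\ `|h' n - c'| < e.
Proof.
move=> hc hc' e0; have [N HN] := hc e e0; have [N' HN'] := hc' e e0.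
by exists (maxn N N') => n; rewrite geq_max => /andP[/HN ? /HN' ?].
Qed.

Lemma tends_toD h h' c c' :
  tends_to h c -> tends_to h' c' -> tends_to (fun n => h n + h' n) (c + c').
Proof.
move=> hc hc' e e0; have e20 : 0 < e / 2 by rewrite divr_gt0.
have [N HN] := tends_to2 hc hc' e20; exists N => n /HN[h1 h2].
rewrite (_ : _ - _ = (h n - c) + (h' n - c')); last by ring.
by rewrite (le_lt_trans (ler_normD _ _)) // [ltRHS](splitr e) ltrD.
Qed.

Lemma tends_toM h h' c c' :
  tends_to h c -> tends_to h' c' -> tends_to (fun n => h n * h' n) (c * c').
Proof.
move=> hc hc' e e0; pose B : K := `|c| + `|c'| + 1.
have B0 : 0 < B by rewrite ltr_wpDl // addr_ge0.
have d0 : 0 < e / (B + e) by rewrite divr_gt0 // addr_gt0.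
have [N HN] := tends_to2 hc hc' d0; exists N => n /HN[h1 h2].
(* [d <= 1] bounds the quadratic error term by [d], the total error by [d * B], and [d * B < e]. *)
set d := e / (B + e) in d0 h1 h2.
have Be0 : 0 < B + e by rewrite addr_gt0.
have d1 : d <= 1 by rewrite /d (ler_pdivrMr _ _ Be0) mul1r lerDr ltW.
rewrite (_ : _ - _ = (h n - c) * (h' n - c') + c * (h' n - c') + c' * (h n - c));
  last by ring.
apply: (@le_lt_trans _ _ (d * B)).
  rewrite (le_trans (ler_normD _ _)) //.
  rewrite (_ : d * B = d * 1 + `|c| * d + `|c'| * d); last by rewrite /B; ring.
  apply: lerD; last by rewrite normrM ler_wpM2l // ltW.
  rewrite (le_trans (ler_normD _ _)) //.
  apply: lerD; last by rewrite normrM ler_wpM2l // ltW.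
  by rewrite normrM ler_pM // ltW // (lt_le_trans h2).
by rewrite /d mulrAC (ltr_pdivrMr _ _ Be0) ltr_pM2l // ltrDl.
Qed.

Lemma tends_to_sum (I : eqType) (s : seq I) (H : I -> nat -> K) (C : I -> K) :
  (forall i, i \in s -> tends_to (H i) (C i)) ->
  tends_to (fun n => \sum_(i <- s) H i n) (\sum_(i <- s) C i).
Proof.
elim: s => [|i s IHs] HC.
  by rewrite big_nil; apply: tends_to_ext (tends_to_cst 0) => n; rewrite big_nil.
have HCs : forall j, j \in s -> tends_to (H j) (C j).
  by move=> j js; apply: HC; rewrite inE js orbT.
rewrite big_cons; apply: tends_to_ext (tends_toD (HC i (mem_head _ _)) (IHs HCs)).
by move=> n; rewrite big_cons.
Qed.

Lemma tends_to_prod (I : Type) (s : seq I) (H : I -> nat -> K) (C : I -> K) :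
  (forall i, tends_to (H i) (C i)) ->
  tends_to (fun n => \prod_(i <- s) H i n) (\prod_(i <- s) C i).
Proof.
move=> HC; elim: s => [|i s IHs].
  by rewrite big_nil; apply: tends_to_ext (tends_to_cst 1) => n; rewrite big_nil.
rewrite big_cons; apply: tends_to_ext (tends_toM (HC i) IHs) => n.
by rewrite big_cons.
Qed.

Lemma tends_toX h c k : tends_to h c -> tends_to (fun n => h n ^+ k) (c ^+ k).
Proof.
move=> hc; elim: k => [|k IHk]; first exact: tends_to_cst.
by rewrite exprS; apply: tends_to_ext (tends_toM hc IHk) => n; rewrite exprS.
Qed.

Lemma tends_to_norm_ge h c : tends_to h c -> c != 0 ->
  exists N, forall n, (N <= n)%N -> `|c| / 2 < `|h n|.
Proof.
move=> hc c0; have e0 : 0 < `|c| / 2 by rewrite divr_gt0 ?normr_gt0.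
have [N HN] := hc _ e0; exists N => n /HN hn.
rewrite -(ltrD2r (`|c| / 2)) -splitr.
rewrite (@le_lt_trans _ _ (`|h n| + `|h n - c|)) ?ltrD2l //.
by rewrite -[in leLHS](subKr (h n) c) ler_normB.
Qed.

Lemma tends_to_neq0 h c : tends_to h c -> c != 0 ->
  exists N, forall n, (N <= n)%N -> h n != 0.
Proof.
move=> hc c0; have [N HN] := tends_to_norm_ge hc c0; exists N => n /HN hn.
by rewrite -normr_gt0 (le_lt_trans _ hn) // divr_ge0.
Qed.

Lemma tends_toV h c : tends_to h c -> c != 0 -> tends_to (fun n => (h n)^-1) c^-1.
Proof.
move=> hc c0 e e0; have [N1 H1] := tends_to_norm_ge hc c0.
have nc : 0 < `|c| by rewrite normr_gt0.
have d0 : 0 < e * (`|c| / 2 * `|c|) by rewrite !mulr_gt0 // invr_gt0.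
have [N2 H2] := hc _ d0; exists (maxn N1 N2) => n.
rewrite geq_max => /andP[/H1 h1 /H2 h2].
have hn0 : 0 < `|h n| by rewrite (le_lt_trans _ h1) // divr_ge0.
have hn : h n != 0 by rewrite -normr_gt0.
have -> : (h n)^-1 - c^-1 = - (h n - c) / (h n * c) by field; apply/andP.
rewrite normrM normrN normfV normrM ltr_pdivrMr ?mulr_gt0 //.
by rewrite (lt_trans h2) // ltr_pM2l // ltr_pM2r.
Qed.

Lemma tends_toXz h c (k : int) : tends_to h c -> c != 0 ->
  tends_to (fun n => h n ^ k) (c ^ k).
Proof.
move=> hc c0; case: k => k; first exact: tends_toX.
by apply: tends_toV; [apply: tends_toX|rewrite expf_neq0].
Qed.

Lemma tends_to_eventually0 h c :
  tends_to h c -> (exists N, forall n, (N <= n)%N -> h n = 0) -> c = 0.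
Proof.
move=> hc [N HN]; apply/eqP/negPn/negP => c0.
have [N' HN'] := tends_to_neq0 hc c0.
by have := HN' _ (leq_maxr N N'); rewrite HN ?leq_maxl ?eqxx.
Qed.

End Limits.

(* [tpow a n] is [t ^ a] for [t = exp (- n)], so [t] tends to [0+]. *)
Definition tpow (a : RR) (n : nat) : CC := (Rtrigo_def.exp (- (a * n%:R)))%:C%C.

Lemma tpowD a b n : tpow (a + b) n = tpow a n * tpow b n.
Proof.
rewrite /tpow -rmorphM /=; congr (_%:C%C).
by rewrite mulrDl opprD -RplusE Exp_prop.exp_plus.
Qed.

Lemma tpow0 n : tpow 0 n = 1.
Proof. by rewrite /tpow mul0r oppr0 (Rtrigo_def.exp_0). Qed.

Lemma tpow_neq0 a n : tpow a n != 0.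
Proof.
apply/negP => /eqP e; have := tpow0 n; rewrite -(subrr a) tpowD e mul0r.
by move/esym/eqP; rewrite oner_eq0.
Qed.

Lemma tpowN a n : tpow (- a) n = (tpow a n)^-1.
Proof.
apply: (mulfI (tpow_neq0 a n)).
by rewrite -tpowD subrr tpow0 mulfV ?tpow_neq0.
Qed.

Lemma tpowMn a k n : tpow (a * k%:R) n = tpow a n ^+ k.
Proof.
elim: k => [|k IHk]; first by rewrite mulr0 tpow0.
by rewrite mulrSr mulrDr mulr1 tpowD IHk exprSr.
Qed.

Lemma tpowMz a (k : int) n : tpow (k%:~R * a) n = tpow a n ^ k.
Proof.
case: k => k; first by rewrite mulrC tpowMn.
by rewrite NegzE rmorphN /= mulNr tpowN mulrC tpowMn -exprnN.
Qed.

Lemma tpow_sum (I : Type) (s : seq I) (F : I -> RR) n :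
  tpow (\sum_(i <- s) F i) n = \prod_(i <- s) tpow (F i) n.
Proof.
by apply: (big_morph (fun a => tpow a n)) => [a b|]; rewrite ?tpowD ?tpow0.
Qed.

Lemma tpow_to0 a : 0 < a -> tends_to (tpow a) 0.
Proof.
move=> a0 e; case: e => x y; rewrite ltcE /= => /andP[/eqP -> x0].
(* [exp (a * n) >= 1 + a * n] exceeds [x^-1] once [n > x^-1 / a]. *)
exists (Num.bound (x^-1 / a)) => n le_n; rewrite subr0.
have n0 : x^-1 / a < n%:R.
  have xa0 : 0 <= x^-1 / a by rewrite ltW // divr_gt0 // invr_gt0.
  by apply: lt_le_trans (archi_boundP xa0) _; rewrite ler_nat.
have ean : x^-1 < Rtrigo_def.exp (a * n%:R).
  have /RleP := Rpower.exp_ineq1_le (a * n%:R); rewrite RplusE; apply: lt_le_trans.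
  by rewrite ltr_wpDl // mulrC -ltr_pdivrMr.
have e0 : 0 < Rtrigo_def.exp (a * n%:R) by rewrite (lt_trans _ ean) // invr_gt0.
rewrite /tpow -RoppE Rpower.exp_Ropp RinvE ger0_norm ?ler0c ?invr_ge0 ?ltW //.
by rewrite ltcR invf_plt.
Qed.

(** Turns the minimality test in [initial_form] into equality with one lowest weight [v], which is
    [x0] for the empty list. *)
Lemma seq_min_spec (T : eqType) (d : Order.disp_t) (F : orderType d) (x0 : F)
    (f : T -> F) (s : seq T) :
  exists v, forall a, a \in s ->
    (v <= f a)%O /\ all (fun b => f a <= f b)%O s = (f a == v).
Proof.
have [v [vs sv]] : exists v, (s = [::] \/ exists2 a, a \in s & f a = v) /\
    forall a, a \in s -> (v <= f a)%O.
  elim: s => [|a s [v [vs sv]]]; first by exists x0; split=> //; left.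
  have [av|va] := leP (f a) v.
    exists (f a); split; first by right; exists a; rewrite ?mem_head.
    by move=> b; rewrite inE => /predU1P[->//|/sv]; apply: le_trans.
  case: vs => [s0|[b bs fb]].
    exists (f a); rewrite s0; split; first by right; exists a; rewrite ?mem_head.
    by move=> b; rewrite inE => /eqP->.
  exists v; split; first by right; exists b; rewrite ?inE ?bs ?orbT.
  by move=> c; rewrite inE => /predU1P[->|/sv//]; apply: ltW.
exists v => a sa; split; first exact: sv.
apply/allP/eqP => [min_a|-> b]; last exact: sv.
case: vs => [s0|[b bs fb]]; first by rewrite s0 in sa.
by apply/eqP; rewrite eq_le sv // andbT -fb min_a.
Qed.

(** * Initial forms at the leading coefficients of a curve *)

Section LimitPoint.
Variables (n : nat) (S : ('I_n -> CC) -> Prop) (w : 'I_n -> RR).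
Variables (y : nat -> 'I_n -> CC) (d : 'I_n -> CC).
Hypothesis yS : exists N, forall j, (N <= j)%N -> S (y j).
Hypothesis yd : forall i, tends_to (fun j => tpow (- w i) j * y j i) (d i).

(** After division by [t ^ v], with [v] the lowest weight in [g], the terms of weight [v] tend to
    those of the initial form at [d], the other terms tend to [0], and the sum is eventually [0]. *)
Lemma initial_form_limit g : vanishing_ideal S g -> (initial_form w g).@[d] = 0.
Proof.
move=> gS; have [v vP] := seq_min_spec 0 (Defs.mweight w) (msupp g).
pose h j := tpow (- v) j * g.@[y j].
apply: (@tends_to_eventually0 _ h); last first.
  by have [N HN] := yS; exists N => j /HN /gS gy; rewrite /h gy mulr0.
have hE j : \sum_(a <- msupp g) g@_a * (tpow (Defs.mweight w a - v) j *
    \prod_i (tpow (- w i) j * y j i) ^+ a i) = h j.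
  rewrite /h mevalE mulr_sumr; apply: eq_bigr => a _.
  rewrite tpowD /Defs.mweight tpow_sum [RHS]mulrCA; congr (_ * _).
  rewrite mulrAC mulrC; congr (_ * _); rewrite -big_split /=.
  apply: eq_bigr => i _.
  by rewrite tpowMn exprMn mulrA -exprMn -tpowD subrr tpow0 expr1n mul1r.
apply: tends_to_ext hE _.
have -> : (initial_form w g).@[d] = \sum_(a <- msupp g)
    g@_a * ((Defs.mweight w a == v)%:R * \prod_i d i ^+ a i).
  rewrite /initial_form raddf_sum /= big_mkcond /=; apply: eq_big_seq => a ag.
  have [_ ->] := vP a ag; case: eqP => _; last by rewrite mul0r mulr0.
  by rewrite mevalZ mevalX mul1r.
apply: tends_to_sum => a ag; apply: tends_toM; first exact: tends_to_cst.
apply: tends_toM; last by apply: tends_to_prod => i; apply/tends_toX/yd.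
have [le_va _] := vP a ag; have [->|ne] := eqVneq.
  by apply: tends_to_ext (tends_to_cst 1) => j; rewrite subrr tpow0.
by apply: tpow_to0; rewrite subr_gt0 lt_neqAle eq_sym ne.
Qed.

Lemma trop_closure_limit : (forall i, d i != 0) -> trop_closure S w.
Proof.
move=> d0 [a [k [h [g [gI Xa]]]]].
have : 'X_[a].@[d] = 0 :> CC.
  rewrite Xa raddf_sum /= big1 // => j _.
  by rewrite mevalM (initial_form_limit (gI j)) mulr0.
by rewrite mevalX => /eqP; apply/negP/prodf_neq0 => i _; apply: expf_neq0.
Qed.

End LimitPoint.

(** Every monomial exhibited below in an initial ideal comes from a polynomial of this shape. *)
Lemma initial_form_lead n (v : 'I_n -> RR) (a : 'X_{1..n}) (q : {mpoly CC[n]}) :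
  (forall b, b \in msupp q -> Defs.mweight v a < Defs.mweight v b) ->
  initial_form v ('X_[a] - q) = 'X_[a].
Proof.
move=> qa; have qa0 : q@_a = 0.
  by apply/eqP; rewrite mcoeff_eq0; apply/negP => /qa; rewrite ltxx.
have supp b : b \in msupp ('X_[a] - q) ->
    b = a \/ Defs.mweight v a < Defs.mweight v b.
  move=> /msuppB_le; rewrite mem_cat msuppX inE => /orP[/eqP|/qa]; by [left|right].
have ca : ('X_[a] - q)@_a = 1 by rewrite mcoeffB mcoeffX eqxx qa0 subr0.
have sa : a \in msupp ('X_[a] - q) by rewrite mcoeff_msupp ca oner_eq0.
rewrite /initial_form -big_filter.
have -> : [seq b <- msupp ('X_[a] - q) |
    all (fun c => Defs.mweight v b <= Defs.mweight v c)
      (msupp ('X_[a] - q))] = [:: a].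
  rewrite -[RHS](filter_pred1_uniq (msupp_uniq _) sa).
  apply: eq_in_filter => b sb /=.
  apply/allP/eqP => [/(_ a sa)|-> c /supp[->//|/ltW//]].
  by have [//|lt_ab] := supp b sb; rewrite leNgt lt_ab.
by rewrite big_seq1 ca scale1r.
Qed.

Lemma mweight1 n (v : 'I_n -> RR) i : Defs.mweight v U_(i)%MM = v i.
Proof.
rewrite /Defs.mweight (bigD1 i) //= mnm1E eqxx mulr1 big1 ?addr0 // => j ne.
by rewrite mnm1E eq_sym (negPf ne) mulr0.
Qed.

(** * The Bergman fan and the tropicalization of a linear space *)

Section Bergman.
Variables (r m : nat) (U : 'M[CC]_(r, m)).
Implicit Types w : 'I_r -> RR.

Definition heavier_rows w (k : 'I_r) : 'M[CC]_(r, m) :=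
  \matrix_(l, j) (if w k < w l then U l j else 0).

(** By the greedy algorithm this says that each [k] lies in a basis of maximal [w]-weight of the row
    matroid. *)
Definition bergman w := forall k, ~~ (row k U <= heavier_rows w k)%MS.

Lemma heavier_rows_linforms w k (D : 'rV[CC]_r) x :
  row k U = D *m heavier_rows w k ->
  linforms U x k = \sum_(l | w k < w l) D 0 l * linforms U x l.
Proof.
move=> e; rewrite [RHS]big_mkcond /= /linforms.
transitivity (\sum_l \sum_j D 0 l * (if w k < w l then U l j else 0) * x j).
  rewrite exchange_big /=; apply: eq_bigr => j _; rewrite -mulr_suml.
  congr (_ * _); move/rowP/(_ j): e; rewrite !mxE => ->.
  by apply: eq_bigr => l _; rewrite mxE.
apply: eq_bigr => l _; case: ifP => _; last first.
  by rewrite big1 // => j _; rewrite mulr0 mul0r.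
by rewrite mulr_sumr; apply: eq_bigr => j _; rewrite mulrA.
Qed.

Lemma trop_closure_bergman w : trop_closure (imU U) w -> bergman w.
Proof.
move=> tw k; apply/negP => /submxP[D e]; apply: tw.
pose q : {mpoly CC[r]} := \sum_(l | w k < w l) D 0 l *: 'X_l.
exists U_(k)%MM, 1%N, (fun=> 1), (fun=> 'X_k - q); split=> [_ _ [x ->]|].
  have qE : q.@[linforms U x] = linforms U x k.
    rewrite (heavier_rows_linforms x e) /q raddf_sum; apply: eq_bigr => l _ /=.
    by rewrite mevalZ mevalXU.
  by rewrite mevalB mevalXU qE subrr.
rewrite big_ord1 mul1r initial_form_lead // => b.
have : forall l, w k < w l -> b \in msupp (D 0 l *: 'X_l : {mpoly CC[r]}) ->
    Defs.mweight w U_(k) < Defs.mweight w b.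
  by move=> l wl /msuppZ_le; rewrite msuppX inE => /eqP->; rewrite !mweight1.
rewrite /q; elim/big_rec: _ => [_|l p wl IHp H]; first by rewrite msupp0.
by move=> /msuppD_le; rewrite mem_cat => /orP[/(H l wl)//|/(IHp H)].
Qed.

Lemma bergman_curve w : bergman w ->
  exists (x : nat -> 'I_m -> CC) (c : 'I_r -> CC), (forall k, c k != 0) /\
    forall k, tends_to (fun n => tpow (- w k) n * linforms U (x n) k) (c k).
Proof.
move=> bw.
(* The columns of [cokermx A] are orthogonal to the heavier rows; as row [k] is outside their span,
   some column pairs with it to a nonzero [y], and is scaled by [y^-1]. *)
have /choice[xi xiP] : forall k, exists xi : 'I_m -> CC, linforms U xi k = 1 /\
    forall l, w k < w l -> linforms U xi l = 0.
  move=> k; have := bw k; rewrite submxE.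
  set A := heavier_rows w k => nz.
  have /existsP[j nj] : [exists j, (row k U *m cokermx A) 0 j != 0].
    apply: contraNT nz => /existsPn z; apply/eqP/rowP => j; rewrite [RHS]mxE.
    by have /negPn/eqP := z j.
  set y := (row k U *m cokermx A) 0 j in nj.
  exists (fun i => cokermx A i j / y); split.
    rewrite /linforms; under eq_bigr do rewrite mulrA; rewrite -mulr_suml.
    rewrite (_ : \sum_i _ = y) ?divff // /y [RHS]mxE.
    by apply: eq_bigr => i _; rewrite [row k U 0 i]mxE.
  move=> l wl; rewrite /linforms; under eq_bigr do rewrite mulrA.
  rewrite -mulr_suml; have /matrixP/(_ l j) := mulmx_coker A.
  rewrite [LHS]mxE [RHS]mxE => A0.
  rewrite (_ : \sum_i _ = 0) ?mul0r // -[RHS]A0; apply: eq_bigr => i _.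
  by rewrite [A l i]mxE wl.
(* A generic [s] keeps all leading coefficients nonzero when several rows have
   the same weight. *)
pose q l : {poly CC} := \poly_(k < r) (if insub k is Some k' then
   (if w k' == w l then linforms U (xi k') l else 0) else 0).
have qE l (k : 'I_r) : (q l)`_k = if w k == w l then linforms U (xi k) l else 0.
  by rewrite coef_poly ltn_ord valK.
(* The factor [q l] is nonzero because its [l]-th coefficient is [1]. *)
have q0 : \prod_l q l != 0.
  apply/prodf_neq0 => l _; apply/negP => /eqP ql0.
  have := qE l l; rewrite ql0 coef0 eqxx (xiP l).1 => /esym/eqP.
  by rewrite oner_eq0.
have [s sP] := closed_nonrootP _ q0.
pose x n j := \sum_(k < r) s ^+ k * tpow (w k) n * xi k j.
exists x, (fun l => (q l).[s]); split=> [l|l].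
  by apply: contra sP => ql; rewrite /root horner_prod (bigD1 l) //= (eqP ql) mul0r.
have -> : (q l).[s] =
    \sum_(k < r) (s ^+ k * (if w k == w l then linforms U (xi k) l else 0)).
  rewrite /q horner_poly; apply: eq_bigr => k _.
  by rewrite valK mulrC.
apply: (@tends_to_ext _ (fun n =>
    \sum_(k < r) s ^+ k * (tpow (w k - w l) n * linforms U (xi k) l))).
  move=> n; rewrite /linforms /x mulr_sumr.
  under [in RHS]eq_bigr do rewrite !mulr_sumr.
  rewrite exchange_big /=; apply: eq_bigr => k _.
  rewrite !mulr_sumr; apply: eq_bigr => j _.
  by rewrite tpowD; ring.
apply: tends_to_sum => k _; apply: tends_toM; first exact: tends_to_cst.
(* Equal weights give the coefficient of [q l]; for [w k < w l] the form [l] kills [xi k]; for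
   [w k > w l] the power of [t] tends to [0]. *)
have [e|ne] := eqVneq.
  by apply: tends_to_ext (tends_to_cst _) => n; rewrite e subrr tpow0 mul1r.
have [lt|gt|e] := ltgtP (w k) (w l); last by rewrite e eqxx in ne.
  apply: tends_to_ext (tends_to_cst _) => n.
  by rewrite (xiP k).2 // mulr0.
rewrite -(mul0r (linforms U (xi k) l)); apply: tends_toM (tends_to_cst _).
by apply: tpow_to0; rewrite subr_gt0.
Qed.

End Bergman.

Lemma bergman_trop_closure r m (U : 'M[CC]_(r, m)) w :
  bergman U w -> trop_closure (imU U) w.
Proof.
move=> /bergman_curve[x [c [c0 xc]]].
apply: (@trop_closure_limit _ _ _ (fun n => linforms U (x n)) c) => //.
by exists 0%N => n _; exists (x n).
Qed.

Lemma bergman_trop_closure_image r m s (U : 'M[CC]_(r, m)) (V : 'M[int]_(s, r)) w :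
  bergman U w -> trop_closure (image_fUV U V) (Vmap V w).
Proof.
move=> /bergman_curve[x [c [c0 xc]]].
apply: (@trop_closure_limit _ _ _ (fun n => fUV U V (x n))
  (fun i => \prod_k c k ^ V i k)).
(* The nonzero limits make all forms eventually nonzero, so the points lie in the domain of the
   rational map. *)
- have /choice[N HN] : forall k, exists N, forall n, (N <= n)%N ->
      linforms U (x n) k != 0.
    move=> k; have [N HN] := tends_to_neq0 (xc k) (c0 k).
    by exists N => n /HN; rewrite mulf_eq0 negb_or => /andP[].
  exists (\max_k N k)%N => n le_n; exists (x n); split=> // k.
  by apply: HN; apply: leq_trans le_n; apply: leq_bigmax.
- move=> i; apply: (@tends_to_ext _ (fun n =>
      \prod_k (tpow (- w k) n * linforms U (x n) k) ^ V i k)).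
    move=> n; rewrite tpowN /Vmap tpow_sum -prodfV -big_split /=.
    by apply: eq_bigr => k _; rewrite tpowMz tpowN expfzMl exprz_inv invr_expz.
  by apply: tends_to_prod => k; apply: tends_toXz.
- by move=> i; apply/prodf_neq0 => k _; apply: expfz_neq0.
Qed.

(** * Lifting a point of the tropicalization of [Y_UV] along [V] *)

Section Lifting.
Variables (r m s : nat) (U : 'M[CC]_(r, m)) (V : 'M[int]_(s, r)) (z : 'I_s -> RR).

(** The functions on this type form the ring to which the subring argument applies. It is the zero
    ring when a row of [U] is zero, so the ring there may be trivial. *)
Definition torus_point := {x : 'I_m -> CC | forall k, linforms U x k != 0}.

Definition lmon (u : {ffun 'I_r -> int}) : torus_point -> CC :=
  fun x => \prod_k linforms U (sval x) k ^ u k.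

Lemma lmonD (u v : {ffun 'I_r -> int}) : lmon (u + v) = lmon u * lmon v.
Proof.
apply/funext => x; rewrite /lmon [RHS]/GRing.mul /= -big_split /=.
by apply: eq_bigr => k _; rewrite ffunE expfzDr // (svalP x).
Qed.

Lemma lmon0 : lmon 0 = 1.
Proof.
by apply/funext => x; rewrite /lmon big1 // => k _; rewrite ffunE expr0z.
Qed.

Lemma lmon_subV u v : lmon (u - v) * lmon (v - u) = 1.
Proof. by rewrite -lmonD addrA subrK subrr lmon0. Qed.

Definition delta_exp (k : 'I_r) : {ffun 'I_r -> int} := [ffun j => (j == k)%:Z].

Lemma lmon_delta k l x :
  lmon (delta_exp k - delta_exp l) x = linforms U (sval x) k / linforms U (sval x) l.
Proof.
have lmon1 j : lmon (delta_exp j) x = linforms U (sval x) j.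
  rewrite /lmon (bigD1 j) //= ffunE eqxx expr1z big1 ?mulr1 // => i ne.
  by rewrite ffunE (negPf ne) expr0z.
apply: (canRL (mulfK (svalP x l))); rewrite -!lmon1.
by have := congr1 (fun h => h x) (lmonD (delta_exp k - delta_exp l) (delta_exp l));
  rewrite subrK => ->.
Qed.

Definition heavy (v : RR) (q : {mpoly CC[s]}) :=
  forall b, b \in msupp q -> v < Defs.mweight z b.

Lemma mweightD a b : Defs.mweight z (a + b)%MM = Defs.mweight z a + Defs.mweight z b.
Proof.
rewrite /Defs.mweight -big_split /=; apply: eq_bigr => i _.
by rewrite mnmDE natrD mulrDr.
Qed.

Lemma heavyB v p q : heavy v p -> heavy v q -> heavy v (p - q).
Proof.
by move=> hp hq b /msuppB_le; rewrite mem_cat => /orP[/hp|/hq].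
Qed.

Lemma heavyM v v' p q : heavy v p -> heavy v' q -> heavy (v + v') (p * q).
Proof.
move=> hp hq b /msuppM_le /allpairsP[[a c] /= [/hp ha /hq hc ->]].
by rewrite mweightD ltrD.
Qed.

Lemma heavyMX v p a : heavy v p -> heavy (v + Defs.mweight z a) (p * 'X_[a]).
Proof.
move=> hp b /msuppM_le /allpairsP[[c d] /= [/hp hc + ->]].
by rewrite msuppX inE => /eqP->; rewrite mweightD ltrD2r.
Qed.

(* The functions that are Laurent polynomials in [f] all of whose exponents have
   positive [z]-weight; the monomial [N] clears the denominators. *)
Definition positive_part (h : torus_point -> CC) :=
  exists (N : 'X_{1..s}) (q : {mpoly CC[s]}), heavy (Defs.mweight z N) q /\
    forall x, h x * 'X_[N].@[fUV U V (sval x)] = q.@[fUV U V (sval x)].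

Definition constant_function (h : torus_point -> CC) := exists c, h = fun=> c.

Lemma nonunital_subring_positive_part :
  nonunital_subring constant_function positive_part.
Proof.
split.
- by exists 0%MM, 0; split=> [b|x]; rewrite ?msupp0 // mul0r meval0.
- move=> h h' [N [q [hq qE]]] [N' [q' [hq' qE']]].
  exists (N + N')%MM, (q * 'X_[N'] - q' * 'X_[N]); split=> [|x].
    by apply: heavyB; rewrite mweightD; [|rewrite addrC]; apply: heavyMX.
  rewrite mpolyXD mevalB !mevalM -qE -qE' [(h - h') x](_ : _ = h x - h' x) //.
  by ring.
- move=> h h' [N [q [hq qE]]] [N' [q' [hq' qE']]].
  exists (N + N')%MM, (q * q'); split=> [|x].
    by rewrite mweightD; apply: heavyM.
  rewrite mpolyXD !mevalM -qE -qE' [(h * h') x](_ : _ = h x * h' x) //.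
  by ring.
- move=> _ h [c ->] [N [q [hq qE]]]; exists N, (c *: q); split=> [b|x].
    by move=> /msuppZ_le; apply: hq.
  by rewrite mevalZ -qE mulrA.
Qed.

(** Otherwise ['X_[N] - q] vanishes on the image and its initial form is the monomial ['X_[N]]. *)
Lemma trop_closure_positive_part :
  trop_closure (image_fUV U V) z -> ~ positive_part 1.
Proof.
move=> tz [N [q [hq qE]]]; apply: tz.
exists N, 1%N, (fun=> 1), (fun=> 'X_[N] - q).
split; last by rewrite big_ord1 mul1r initial_form_lead.
move=> _ _ [x [x0 ->]]; have := qE (exist _ x x0).
by rewrite mul1r /= mevalB => ->; rewrite subrr.
Qed.

(** The exponent of [f ^ lam] as a Laurent monomial in the linear forms. *)
Definition pull (lam : {ffun 'I_s -> int}) : {ffun 'I_r -> int} :=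
  [ffun k => \sum_i lam i * V i k].

Lemma pullD lam lam' : pull (lam + lam') = pull lam + pull lam'.
Proof.
apply/ffunP => k; rewrite !ffunE -big_split /=.
by apply: eq_bigr => i _; rewrite ffunE mulrDl.
Qed.

Lemma lmon_pull lam x : lmon (pull lam) x = \prod_i fUV U V (sval x) i ^ lam i.
Proof.
rewrite /lmon /fUV.
transitivity (\prod_i \prod_k linforms U (sval x) k ^ (lam i * V i k)).
  rewrite exchange_big /=; apply: eq_bigr => k _; rewrite ffunE.
  apply: (big_morph (fun a => linforms U (sval x) k ^ a)) => [a b|//].
  by rewrite expfzDr // (svalP x).
apply: eq_bigr => i _.
rewrite (big_morph (fun a => a ^ lam i) (fun a b => expfzMl a b _) (exp1rz _ _)).
by apply: eq_bigr => k _; rewrite exprz_exp mulrC.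
Qed.

Lemma positive_part_lmon (lam : {ffun 'I_s -> int}) : 0 < \sum_i (lam i)%:~R * z i ->
  positive_part (lmon (pull lam)).
Proof.
move=> lam0.
(* The positive and negative parts of [lam]; [Negz n] stands for [- n.+1]. Their weights differ by
   [lam . z > 0]. *)
pose pos : 'X_{1..s} := [multinom (if lam i is Posz n then n else 0%N) | i < s].
pose neg : 'X_{1..s} := [multinom (if lam i is Negz n then n.+1 else 0%N) | i < s].
exists neg, 'X_[pos]; split=> [b|x].
  rewrite msuppX inE => /eqP->; rewrite -subr_gt0 /Defs.mweight -sumrB.
  rewrite (eq_bigr (fun i => (lam i)%:~R * z i)) // => i _.
  rewrite !mnmE -mulrBr mulrC; congr (_ * _); case: (lam i) => n.
    by rewrite subr0.
  by rewrite NegzE rmorphN sub0r.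
rewrite lmon_pull !mevalX -big_split /=; apply: eq_bigr => i _.
rewrite !mnmE; case: (lam i) => n; first by rewrite mulr1.
rewrite NegzE -exprnN mulVf // expf_neq0 //.
by apply/prodf_neq0 => k _; apply/expfz_neq0/(svalP x).
Qed.

Lemma trop_closure_lift : trop_closure (image_fUV U V) z ->
  exists w : 'I_r -> RR, bergman U w /\ z = Vmap V w.
Proof.
move=> /trop_closure_positive_part nP1.
have [P [subP P1 posP invP]] :=
  maximal_nonunital_subring nonunital_subring_positive_part nP1.
(* The inequalities [b <= a . w] that the valuation of [P] forces. *)
pose K a (b : RR) := exists lam : {ffun 'I_s -> int}, b = \sum_i (lam i)%:~R * z i /\
  multiplier P (lmon (a - pull lam)).
have KD a b a' b' : K a b -> K a' b' -> K (a + a') (b + b').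
  move=> [lam [-> Ma]] [lam' [-> Ma']]; exists (lam + lam'); split.
    rewrite -big_split /=; apply: eq_bigr => i _.
    by rewrite ffunE intrD mulrDl.
  by rewrite pullD opprD addrACA lmonD; apply: multiplierM.
pose rowV i : {ffun 'I_r -> int} := [ffun k => V i k].
(* The first two blocks together say [V w = z]; the third asks [w k <= w l] whenever the quotient of
   the [k]-th by the [l]-th form is outside [P]. *)
pose cs := [seq (rowV i, z i) | i <- enum 'I_s] ++
  [seq (- rowV i, - z i) | i <- enum 'I_s] ++
  [seq (delta_exp p.2 - delta_exp p.1, 0) | p <- enum {: 'I_r * 'I_r} &
    `[< ~ P (lmon (delta_exp p.1 - delta_exp p.2)) >]].
have KV i : K (rowV i) (z i) /\ K (- rowV i) (- z i).
  pose e : {ffun 'I_s -> int} := [ffun j => (j == i)%:Z].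
  have eV : pull e = rowV i.
    apply/ffunP => k; rewrite !ffunE (bigD1 i) //= ffunE eqxx mul1r big1 ?addr0 //.
    by move=> j ne; rewrite ffunE (negPf ne) mul0r.
  have ez : \sum_j (e j)%:~R * z j = z i.
    rewrite (bigD1 i) //= ffunE eqxx mul1r big1 ?addr0 //.
    by move=> j ne; rewrite ffunE (negPf ne) mul0r.
  have eVN : pull (- e) = - rowV i.
    apply/eqP; rewrite -addr_eq0 -eV -pullD addNr; apply/eqP/ffunP => k.
    by rewrite !ffunE big1 // => j _; rewrite ffunE mul0r.
  split; [exists e | exists (- e)].
    by rewrite ez eV subrr lmon0; split=> //; apply: multiplier1.
  rewrite eVN subrr lmon0; split; last exact: multiplier1.
  by rewrite -ez -sumrN; apply: eq_bigr => j _; rewrite [(- e) j]ffunE rmorphN mulNr.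
have csK c : c \in cs -> K c.1 c.2.
  rewrite !mem_cat => /or3P[] /mapP[p pin ->].
  - exact: (KV p).1.
  - exact: (KV p).2.
  move: pin; rewrite mem_filter => /andP[/asboolP nP _].
  exists 0; split; first by rewrite big1 // => i _; rewrite ffunE mul0r.
  have -> : pull 0 = 0.
    by apply/ffunP => k; rewrite !ffunE big1 // => i _; rewrite ffunE mul0r.
  (* By [invP], a unit outside [P] has its inverse among the multipliers. *)
  rewrite subr0; apply: contrapT => nM; apply: nP.
  by apply: invP nM; apply: lmon_subV.
have [[w wP]|[a [b [[lam [-> Ma]] a0 b0]]]] :=
    fourier_motzkin (index_enum_uniq _) KD csK; last first.
  (* A certificate has [a = 0]; [1] is the product of the multiplier [f ^ (-lam)] and of [f ^ lam],
     which is in [P]. *)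
  case: P1; rewrite -(lmon_subV 0 (pull lam)) subr0.
  have -> : 0 = a by apply/ffunP => k; rewrite ffunE a0 // mem_index_enum.
  by apply/Ma/posP/positive_part_lmon.
have wle k l : ~ P (lmon (delta_exp k - delta_exp l)) -> w k <= w l.
  move=> nP; have := wP (delta_exp l - delta_exp k, 0).
  rewrite !mem_cat; have -> /= : (delta_exp l - delta_exp k, 0) \in
     [seq (delta_exp p.2 - delta_exp p.1, 0 : RR) | p <- enum {: 'I_r * 'I_r} &
    `[< ~ P (lmon (delta_exp p.1 - delta_exp p.2)) >]].
    apply/mapP; exists (k, l) => //; rewrite mem_filter mem_enum andbT.
    exact/asboolP.
  rewrite !orbT => /(_ isT) /= le0.
  have dot j : int_dot (index_enum 'I_r) (delta_exp j) w = w j.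
    rewrite /int_dot (bigD1 j) //= ffunE eqxx mul1r big1 ?addr0 // => i ne.
    by rewrite ffunE (negPf ne) mul0r.
  rewrite -subr_ge0; apply: le_trans le0 _.
  rewrite -(dot k) -(dot l) /int_dot -sumrB; apply: ler_sum => j _.
  rewrite [(delta_exp l - _) j]ffunE [(- delta_exp k) j]ffunE.
  by rewrite rmorphB mulrBl.
exists w; split.
  move=> k; apply/negP => /submxP[D e]; apply: P1.
  (* Dividing the relation by the [k]-th form writes [1] as an element of [P]. *)
  have -> : 1 = \sum_(l | w k < w l)
      ((fun=> D 0 l) : torus_point -> CC) * lmon (delta_exp l - delta_exp k).
    apply/funext => x; rewrite fct_sumE.
    transitivity (\sum_(l | w k < w l)
        D 0 l * linforms U (sval x) l / linforms U (sval x) k).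
      by rewrite -mulr_suml -(heavier_rows_linforms (sval x) e) divff // (svalP x).
    apply: eq_bigr => l _; rewrite -mulrA -lmon_delta.
    exact: erefl.
  apply: (nonunital_subring_sum subP) => l lt_kl.
  case: (subP) => _ _ _; apply; first by exists (D 0 l).
  (* A quotient outside [P] would give [w l <= w k]. *)
  by apply: contrapT => /wle; rewrite leNgt lt_kl.
apply/funext => i; apply/eqP; rewrite eq_le; apply/andP; split.
  have := wP (rowV i, z i).
  rewrite !mem_cat map_f ?mem_enum // => /(_ isT) /le_trans; apply.
  by rewrite /int_dot /Vmap; under eq_bigr do rewrite ffunE.
have := wP (- rowV i, - z i).
rewrite !mem_cat (map_f (fun i => (- rowV i, - z i))) ?mem_enum // orbT => /(_ isT).
rewrite lerNl => /(le_trans _); apply.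
rewrite /int_dot /Vmap -sumrN; apply: ler_sum => k _.
by rewrite !ffunE rmorphN mulNr opprK.
Qed.

End Lifting.

(* tau(Y_UV) = V . tau(im U) *)
Theorem theorem3p1 (r m s : nat) (U : 'M[CC]_(r, m)) (V : 'M[int]_(s, r))
  (z : 'I_s -> RR) :
  trop_closure (image_fUV U V) z <->
  exists w : 'I_r -> RR, trop_closure (imU U) w /\ z = Vmap V w.
Proof.
split=> [/trop_closure_lift[w [bw ->]]|[w [/trop_closure_bergman bw ->]]].
  by exists w; split=> //; apply: bergman_trop_closure.
exact: bergman_trop_closure_image.
Qed.
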